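(* Let $X \subset \mathbb{Z}^2$ be finite. Suppose $X' \subset \mathbb{Z}^2$ is a digitally convex disk with bounding curve $S \subset X$ such that $X' \setminus S$ is a $c_2$-component of $\mathbb{Z}^2 \setminus X$. Suppose there is a $c_2$-continuous function $F: S \to S$ such that for each $x \in S$, $$N^*(X,c_2,x) \cap N^*(X,c_2,F(x)) = \emptyset.$$ Then $(X,c_2)$ does not have the approximate fixed point property (AFPP).
   Context: Adjacency: for distinct $x=(x_1,x_2), y=(y_1,y_2)\in\mathbb{Z}^2$ and $u\in\{1,2\}$, $x$ and $y$ are $c_u$-adjacent if $|x_i-y_i|=1$ for at most $u$ indices $i$, and $x_j=y_j$ for every index $j$ with $|x_j-y_j|\ne 1$ (so $c_1$ is 4-adjacency and $c_2$ is 8-adjacency). A set $A\subset\mathbb{Z}^2$ is $\kappa$-connected if any two of its points are joined by a finite sequence of points of $A$ in which consecutive points are $\kappa$-adjacent; $\kappa$-components are maximal $\kappa$-connected subsets. For $x\in X$, $N^*(X,c_2,x)=\{y\in X \mid y=x \text{ or } y \text{ is } c_2\text{-adjacent to } x\}$. AFPP: $(X,c_2)$ denotes $X$ with the $c_2$ adjacency. A function $f:A\to B$ between subsets of $\mathbb{Z}^2$ is $c_2$-continuous if whenever $x,x'\in A$ are $c_2$-adjacent, $f(x)$ and $f(x')$ are $c_2$-adjacent or equal. $(X,c_2)$ has the AFPP if for every $c_2$-continuous $f:X\to X$ there is $x\in X$ such that $f(x)$ is $c_2$-adjacent or equal to $x$. Disks: a $c_2$-closed curve is a set $S=\{s_i\}_{i=0}^{m-1}\subset\mathbb{Z}^2$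 of pairwise distinct points with $s_i$ $c_2$-adjacent to $s_{(i+1)\bmod m}$ for $0\le i\le m-1$. If $S$ is a $c_2$-closed curve such that $\mathbb{Z}^2\setminus S$ has exactly two $c_1$-components, one finite and the other infinite, then the finite one is denoted $Int(S)$, the set $D=S\cup Int(S)$ is a (digital) disk, and $S$ is a bounding curve of $D$. (A disk may have several bounding curves.) Convexity: a (digital) line segment is a set of $n>1$ collinear points of $\mathbb{Z}^2$ that is $\kappa$-connected for some $\kappa\in\{c_1,c_2\}$ (necessarily horizontal, vertical, or of slope $\pm1$). A finite set $Z\subset\mathbb{Z}^2$ is (digitally) convex if it is a single point, or a digital line segment, or a digital disk with a bounding curve $S$ such that the endpoints of the maximal digital line segments of $S$ are the vertices of the convex hull of $Z$ in $\mathbb{R}^2$. A digitally convex disk is a digital disk that is digitally convex. *)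

(* Defs.v *)
From mathcomp Require Import all_boot all_order all_algebra.
From mathcomp Require Import boolp classical_sets functions cardinality.
From mathcomp Require Import reals topology interval_inference convex.

Set Implicit Arguments.
Unset Strict Implicit.
Unset Printing Implicit Defensive.

Import Order.TTheory GRing.Theory Num.Theory.

Local Open Scope classical_set_scope.
Local Open Scope ring_scope.
Local Open Scope convex_scope.
Local Open Scope card_scope.

(* c_u-adjacency: 4-adjacency for u = 1, 8-adjacency for u = 2.  The sum counts
   the coordinates in which x and y differ by exactly 1. *)
Definition adj (u : nat) : rel (int * int) := fun x y =>
  [&& x != y,
      ((`|x.1 - y.1| == 1)%R + (`|x.2 - y.2| == 1)%R <= u)%N,
      (`|x.1 - y.1| != 1) ==> (x.1 == y.1) &
      (`|x.2 - y.2| != 1) ==> (x.2 == y.2)].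

Definition dconnected (u : nat) (A : set (int * int)) : Prop :=
  forall x y, A x -> A y ->
    exists p : seq (int * int),
      [/\ path (adj u) x p, last x p = y & [set` x :: p] `<=` A].

Definition dcomponents (u : nat) (A : set (int * int)) : set (set (int * int)) :=
  [set C | [/\ C `<=` A, dconnected u C &
     forall C', C' `<=` A -> dconnected u C' -> C `<=` C' -> C' = C]].

(* N^*(X, c_2, x) *)
Definition Nstar (X : set (int * int)) (x : int * int) : set (int * int) :=
  [set y | X y /\ (y = x \/ adj 2 y x)].

(* Maps A -> B between subsets of Z^2 are total maps used only on A, so that
   c_2-continuity is relative to A. *)
Definition c2_continuous (A : set (int * int)) (f : int * int -> int * int) : Prop :=
  forall x x', A x -> A x' -> adj 2 x x' -> adj 2 (f x) (f x') \/ f x = f x'.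

Definition AFPP (X : set (int * int)) : Prop :=
  forall f : int * int -> int * int,
    set_fun X X f -> c2_continuous X f ->
    exists2 x, X x & adj 2 (f x) x \/ f x = x.

(* A cyclic enumeration without repetition of a c_2-closed curve. *)
Definition closed_curve_seq (c : seq (int * int)) : Prop :=
  c != [::] /\ ucycle (adj 2) c.

Definition closed_curve (S : set (int * int)) : Prop :=
  exists2 c, closed_curve_seq c & S = [set` c].

Definition bounding_curve (S D : set (int * int)) : Prop :=
  closed_curve S /\
  exists I E : set (int * int),
    [/\ dcomponents 1 (~` S) = [set I; E], finite_set I, infinite_set E &
        D = S `|` I].

Definition digital_disk (D : set (int * int)) : Prop :=
  exists S, bounding_curve S D.

(* The Euclidean plane: the regular module R^o provides the vector space (and
   hence the convexity) structure. *)
Definition plane (R : realType) : lmodType R := (R^o * R^o)%type.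

Definition embed (R : realType) (p : int * int) : convex_lmodType (plane R) :=
  (p.1%:~R, p.2%:~R).

Definition collinear (R : realType) (A : set (int * int)) : Prop :=
  exists a d : plane R, d != 0 /\
    forall p, A p -> exists t : R, (embed R p : plane R) = a + t *: d.

Definition digital_segment (R : realType) (A : set (int * int)) : Prop :=
  [/\ exists2 n : nat, (1 < n)%N & A #= `I_n,
      collinear R A &
      dconnected 1 A \/ dconnected 2 A].

Definition segment_endpoint (R : realType) (L : set (int * int)) (p : int * int) : Prop :=
  L p /\ exists2 q, L q &
    forall x, L x -> exists t : {i01 R}, embed R x = embed R p <| t |> embed R q.

(* The line segments of a closed curve are the sets of consecutive points of the
   curve (in its cyclic order) that form a digital line segment.  Taking instead
   all digital segments included in the underlying point set would be wrong: on
   the boundary of [0,n]^2 it would make {(0,1),(1,0)} a maximal segment, and no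
   rectangle would be convex. *)
Definition curve_segment (R : realType) (c : seq (int * int)) (L : set (int * int)) : Prop :=
  digital_segment R L /\ exists i k : nat, L = [set` take k (rot i c)].

Definition maximal_curve_segment (R : realType) (c : seq (int * int))
    (L : set (int * int)) : Prop :=
  curve_segment R c L /\
  forall L', curve_segment R c L' -> L `<=` L' -> L' = L.

Definition convex_hull (R : realType) (A : set (convex_lmodType (plane R))) :
    set (convex_lmodType (plane R)) :=
  smallest (@convex_set R (plane R)) A.

(* For the convex hull of a finite set (a polygon), the vertices are the extreme
   points. *)
Definition vertices (R : realType) (K : set (convex_lmodType (plane R))) :
    set (convex_lmodType (plane R)) :=
  [set v | K v /\ forall a b (t : {i01 R}), K a -> K b ->
     0 < t%:num -> t%:num < 1 -> v = a <| t |> b -> a = v /\ b = v].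

Definition digitally_convex (R : realType) (Z : set (int * int)) : Prop :=
  finite_set Z /\
  [\/ exists x, Z = [set x],
      digital_segment R Z |
      exists c : seq (int * int),
        [/\ closed_curve_seq c, bounding_curve [set` c] Z &
            embed R @` [set p | exists2 L, maximal_curve_segment R c L &
                                          segment_endpoint R L p]
            = vertices (convex_hull (embed R @` Z))]].

Definition digitally_convex_disk (R : realType) (D : set (int * int)) : Prop :=
  digital_disk D /\ digitally_convex R D.

(* Main.v *)
(* The hole C = X' \ S is a finite c_2-component of the complement of X, and this
   alone refutes the AFPP.  Fix p in C.  The crossing numbers of c_2-paths with a
   horizontal ray from p form a cocycle on X, which is not a coboundary, so some
   closed path of X has positive winding number around p; let c be a shortest
   one, of length n.  A closed path that repeats a vertex or crosses itself along
   two diagonals splits into two shorter closed paths of the same total length and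
   winding number, and a simple closed path winds at most once.  Hence c winds
   exactly once and every closed path of winding number w has length at least
   n w.  So the costs 1 - n (crossing number) have no negative cycle: they admit a
   potential h, which induces a c_2-continuous map X -> Z/n sending c_i to i, up to
   a constant.  As n >= 4, the map x |-> c_{h(x) + 2} moves every point to a point
   that is neither equal nor adjacent to it. *)

Require Import Defs.
From mathcomp Require Import all_boot all_order all_algebra.
From mathcomp Require Import boolp classical_sets functions cardinality.
From mathcomp Require Import reals.
From mathcomp Require Import zify ring.

Set Implicit Arguments.
Unset Strict Implicit.
Unset Printing Implicit Defensive.

Import Order.TTheory GRing.Theory Num.Theory.

Local Open Scope ring_scope.

(** * Sums of edge weights along walks and closed walks *)

Section Walks.
Variables (T : eqType) (f : T -> T -> int).

Fixpoint walk_sum (x : T) (s : seq T) : int :=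
  if s is y :: s' then f x y + walk_sum y s' else 0.

Definition cycle_sum (c : seq T) : int :=
  if c is x :: s then walk_sum x (rcons s x) else 0.

Lemma walk_sum_cat x s1 s2 :
  walk_sum x (s1 ++ s2) = walk_sum x s1 + walk_sum (last x s1) s2.
Proof. by elim: s1 x => [|y s1 IH] x /=; rewrite ?add0r // IH addrA. Qed.

Lemma walk_sum_rcons x s y :
  walk_sum x (rcons s y) = walk_sum x s + f (last x s) y.
Proof. by rewrite -cats1 walk_sum_cat /= addr0. Qed.

Lemma cycle_sum_catC s1 s2 : cycle_sum (s1 ++ s2) = cycle_sum (s2 ++ s1).
Proof.
case: s1 s2 => [|x s1] [|y s2]; rewrite ?cats0 //=.
rewrite !rcons_cat !walk_sum_cat /= !walk_sum_rcons; ring.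
Qed.

Lemma cycle_sum_rot i c : cycle_sum (rot i c) = cycle_sum c.
Proof. by rewrite /rot cycle_sum_catC cat_take_drop. Qed.

Lemma cycle_sum_nested x s1 s2 :
  cycle_sum (x :: s1 ++ x :: s2) = cycle_sum (x :: s1) + cycle_sum (x :: s2).
Proof. by rewrite /= rcons_cat walk_sum_cat /= !walk_sum_rcons; ring. Qed.

Lemma map_next (c : seq T) : uniq c -> map (next c) c = rot 1 c.
Proof.
case: c => // x s Us; apply: (@eq_from_nth _ x); first by rewrite size_map size_rot.
move=> i; rewrite size_map => ltis; rewrite (nth_map x) // next_nth mem_nth //.
rewrite index_uniq // rot1_cons nth_rcons; move: ltis; rewrite /= ltnS leq_eqVlt.
case/orP=> [/eqP -> | ->] //; rewrite ltnn eqxx nth_default //.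
Qed.

Lemma walk_sum_zip x s :
  walk_sum x s = \sum_(e <- zip (belast x s) s) f e.1 e.2.
Proof. by elim: s x => [|y s IH] x /=; rewrite ?big_nil // big_cons IH. Qed.

Lemma cycle_sum_next (c : seq T) :
  uniq c -> cycle_sum c = \sum_(a <- c) f a (next c a).
Proof.
case: c => [|x s] Us; first by rewrite big_nil.
rewrite /cycle_sum walk_sum_zip belast_rcons -rot1_cons -(map_next Us).
by rewrite -[X in zip X _]map_id zip_map big_map.
Qed.

End Walks.

(** * Potentials for weights without negative cycles *)

Section Potential.
Variables (T : eqType) (e : rel T) (f : T -> T -> int) (V : seq T) (K : nat).
Hypothesis f_ge : forall x y, - K%:Z <= f x y.
Hypothesis cycle_ge0 :
  forall c, cycle e c -> {subset c <= V} -> 0 <= cycle_sum f c.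

Let walk_to (y x : T) (s : seq T) :=
  [/\ path e x s, {subset x :: s <= V}, uniq (x :: s) & last x s = y].

Lemma walk_sum_ge x s : - (K * size s)%:Z <= walk_sum f x s.
Proof.
elim: s x => [|y s IH] x /=; first by rewrite muln0.
by have := f_ge x y; have := IH y; lia.
Qed.

(** Take for [h y] the least weight of a simple walk in [V] that ends at [y], whatever its start.
    Simple walks have at most [size V] vertices, so their weights are bounded below and the minimum
    exists. *)
Lemma potential_exists :
  exists h : T -> int, forall x y, x \in V -> y \in V -> e x y ->
    h y <= h x + f x y.
Proof.
have min_walk y : y \in V -> exists m : int,
    (exists x s, walk_to y x s /\ walk_sum f x s = m) /\
    (forall x s, walk_to y x s -> m <= walk_sum f x s).
  move=> yV; pose B := (K * size V)%:Z.
  have ge_B x s : walk_to y x s -> - B <= walk_sum f x s.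
    case=> _ sV Us _; have := walk_sum_ge x s.
    have := uniq_leq_size Us sV; rewrite /B /=; nia.
  pose P n := `[< exists x s, walk_to y x s /\ walk_sum f x s + B = n%:Z >].
  have exP : exists n, P n.
    exists (absz B); apply/asboolP; exists y, [::]; split; last by rewrite /=; lia.
    by split=> // z; rewrite inE => /eqP ->.
  case: (ex_minnP exP) => n /asboolP[x [s [xsP xsE]]] n_min.
  exists (n%:Z - B); split; first by exists x, s; split=> //; lia.
  move=> x' s' w'; have := ge_B _ _ w' => ge'.
  have /n_min : P (absz (walk_sum f x' s' + B)).
    by apply/asboolP; exists x', s'; split=> //; lia.
  by lia.
have /boolp.choice[h hP] y : exists m : int, y \in V ->
    (exists x s, walk_to y x s /\ walk_sum f x s = m) /\
    (forall x s, walk_to y x s -> m <= walk_sum f x s).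
  by case: (boolP (y \in V)) => [/min_walk[m ?]|_]; [exists m | exists 0].
exists h => y z yV zV yz.
case: (hP y yV) => -[x [s [[pxs sV Us ls] <-]]] _.
case: (hP z zV) => _ h_min.
have [zs|zs] := boolP (z \in x :: s); last first.
  rewrite -ls -walk_sum_rcons; apply: h_min; split; last by rewrite last_rcons.
  - by rewrite rcons_path pxs ls.
  - move=> t; rewrite -rcons_cons mem_rcons inE => /orP[/eqP->//|]; exact: sV.
  - by rewrite -rcons_cons rcons_uniq zs.
(* If the optimal walk to [y] already visits [z], cut it at [z]: its tail and the edge from [y] to
   [z] form a closed walk, of nonnegative weight. *)
have [s1 [s2 [s_eq l1]]] : exists s1 s2, s = s1 ++ s2 /\ last x s1 = z.
  by case/splitPl: zs => s1 s2 l1; exists s1, s2.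
have loop : 0 <= cycle_sum f (z :: s2).
  apply: cycle_ge0.
    rewrite /= rcons_path; move: pxs ls; rewrite s_eq cat_path last_cat l1.
    by case/andP=> _ -> ->.
  move=> t; rewrite inE => /orP[/eqP->//|ts2]; apply: sV.
  by rewrite s_eq inE mem_cat ts2 !orbT.
have : h z <= walk_sum f x s1.
  apply: h_min; split=> //.
  - by move: pxs; rewrite s_eq cat_path => /andP[].
  - move=> t ts; apply: sV; move: ts; rewrite s_eq !inE mem_cat.
    by case/orP=> ->; rewrite ?orbT.
  - by move: Us; rewrite s_eq -cat_cons cat_uniq => /andP[].
move: loop; rewrite /= walk_sum_rcons s_eq walk_sum_cat l1.
by move: ls; rewrite s_eq last_cat l1 => ->; lia.
Qed.

End Potential.

(** * Linearity of cycle sums, and their vanishing on coboundaries *)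

Section CycleSums.
Variables (T : eqType) (e : rel T).
Implicit Types f g : T -> T -> int.

Lemma walk_sumD f g x s :
  walk_sum (fun a b => f a b + g a b) x s = walk_sum f x s + walk_sum g x s.
Proof. by elim: s x => [|y s IH] x //=; rewrite IH; ring. Qed.

Lemma cycle_sumD f g c :
  cycle_sum (fun a b => f a b + g a b) c = cycle_sum f c + cycle_sum g c.
Proof. by case: c => [|x s]; [ring | apply: walk_sumD]. Qed.

Lemma walk_sumM (k : int) f x s :
  walk_sum (fun a b => k * f a b) x s = k * walk_sum f x s.
Proof. by elim: s x => [|y s IH] x /=; rewrite ?mulr0 // IH mulrDr. Qed.

Lemma cycle_sumM (k : int) f c :
  cycle_sum (fun a b => k * f a b) c = k * cycle_sum f c.
Proof. by case: c => [|x s]; [rewrite mulr0 | apply: walk_sumM]. Qed.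

Lemma walk_sum_size x s : walk_sum (fun _ _ : T => 1) x s = (size s)%:Z.
Proof. by elim: s x => //= y s IH x; rewrite IH. Qed.

Lemma cycle_sum_size c : cycle_sum (fun _ _ : T => 1) c = (size c)%:Z.
Proof. by case: c => //= x s; rewrite walk_sum_size size_rcons. Qed.

Lemma walk_sum_coboundary (g : T -> int) x s :
  walk_sum (fun a b => g b - g a) x s = g (last x s) - g x.
Proof. by elim: s x => [|y s IH] x /=; rewrite ?subrr // IH; ring. Qed.

Lemma cycle_sum_coboundary (g : T -> int) c :
  cycle_sum (fun a b => g b - g a) c = 0.
Proof. by case: c => //= x s; rewrite walk_sum_coboundary last_rcons subrr. Qed.

Lemma eq_cycle_sum f g c :
  (forall a b, e a b -> f a b = g a b) -> cycle e c ->
  cycle_sum f c = cycle_sum g c.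
Proof.
move=> fg; have eq_w x s : path e x s -> walk_sum f x s = walk_sum g x s.
  by elim: s x => //= y s IH x /andP[xy /IH->]; rewrite fg.
by case: c => //= x s; apply: eq_w.
Qed.

End CycleSums.

(** * The relation [near] (c_2-adjacent or equal), crossing numbers and flows *)

Definition near : rel (int * int) := fun a b =>
  [&& a.1 <= b.1 + 1, b.1 <= a.1 + 1, a.2 <= b.2 + 1 & b.2 <= a.2 + 1].

Lemma near_refl : reflexive near.
Proof. by move=> a; rewrite /near; lia. Qed.

Lemma near_sym : symmetric near.
Proof. by move=> a b; rewrite /near; lia. Qed.

Lemma near_cases a b : near a b -> exists k1 k2 : int,
  [/\ b = (a.1 + k1, a.2 + k2), k1 = -1 \/ k1 = 0 \/ k1 = 1 &
      k2 = -1 \/ k2 = 0 \/ k2 = 1].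
Proof.
case: a b => a1 a2 [b1 b2] /and4P[/= ? ? ? ?]; exists (b1 - a1), (b2 - a2).
by split; [congr (_, _); lia | lia..].
Qed.

Ltac decide_int_tests :=
  repeat match goal with
  | |- context [@eq_op ?T ?u ?v] =>
     first [ have -> : (u == v) = false by lia | have -> : (u == v) = true by lia
           | case: (u =P v) => ? ]; rewrite /= ?andbF ?andFb ?andTb
  | |- context [Order.lt ?u ?v] =>
     first [ have -> : (u < v) = false by lia | have -> : (u < v) = true by lia
           | case: (ltP u v) => ? ]; rewrite /= ?andbF ?andFb ?andTb
  | |- context [Order.le ?u ?v] =>
     first [ have -> : (u <= v) = false by lia | have -> : (u <= v) = true by lia
           | case: (leP u v) => ? ]; rewrite /= ?andbF ?andFb ?andTb
  end; by [].

(* Signed crossing number of the edge a -> b with the horizontal ray issued from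
   the point q + (1/2, 1/2) to the right, slightly moved down to avoid the
   crossing points of diagonal edges. *)
Definition crossing (q a b : int * int) : int :=
  ([&& a.2 == q.2, b.2 == q.2 + 1 & q.1 < a.1] : nat)%:Z
  - ([&& b.2 == q.2, a.2 == q.2 + 1 & q.1 < b.1] : nat)%:Z.

(** Summed along a closed path, this counts the traversals from [v] to [z] minus those from [z] to
    [v]. *)
Definition flow (v z a b : int * int) : int :=
  ((a == v) && (b == z) : nat)%:Z - ((a == z) && (b == v) : nat)%:Z.

Section Windings.
Variable c : seq (int * int).
Hypothesis cyc : cycle near c.

Let w x y := cycle_sum (crossing (x, y)) c.
Let t x y x' y' := cycle_sum (flow (x, y) (x', y')) c.

Lemma flow_anti x y x' y' : t x' y' x y = - t x y x' y'.
Proof.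
rewrite -mulN1r -cycle_sumM; apply: (eq_cycle_sum _ cyc) => a b _.
by rewrite /flow; lia.
Qed.

(** Only the lower endpoint of an edge is compared with the start of the ray, so moving that start
    across [(x, y)] affects just the edges between this point and row [y + 1]. *)
Lemma winding_left x y xm x1 y1 : xm = x - 1 -> x1 = x + 1 -> y1 = y + 1 ->
  w xm y = w x y + t x y x1 y1 + t x y x y1 + t x y xm y1.
Proof.
move=> -> -> ->; rewrite -!cycle_sumD; apply: (eq_cycle_sum _ cyc).
case=> a1 a2 b /near_cases[k1 [k2 [-> k1_small k2_small]]].
rewrite /crossing /flow !xpair_eqE /=.
by case: k1_small => [|[]] ->; case: k2_small => [|[]] ->; decide_int_tests.
Qed.

(** Flow conservation in the half-row of the points [(a, y + 1)] with [x <= a]: [w xm y1] counts the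
    edges through its top, the other terms those through its bottom and its left end. *)
Lemma winding_up x y xm x1 y1 : xm = x - 1 -> x1 = x + 1 -> y1 = y + 1 ->
  w xm y1 = w x y + t x y x y1 + t x y x1 y1 + t xm y x y1 + t xm y1 x y1.
Proof.
move=> -> -> ->.
have := cycle_sum_coboundary
  (fun a : int * int => ((a.2 == y + 1) && (x <= a.1) : nat)%:Z) c.
move=> /(congr1 (fun z => w (x - 1) (y + 1) + z)); rewrite addr0 => <-.
rewrite -!cycle_sumD; apply: (eq_cycle_sum _ cyc).
case=> a1 a2 b /near_cases[k1 [k2 [-> k1_small k2_small]]].
rewrite /crossing /flow !xpair_eqE /=.
by case: k1_small => [|[]] ->; case: k2_small => [|[]] ->; decide_int_tests.
Qed.

End Windings.

(* The eight directions, numbered counterclockwise from (1, 0). *)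
Definition shift (k : nat) (v : int * int) : int * int :=
  match k with
  | 0 => (v.1 + 1, v.2) | 1 => (v.1 + 1, v.2 + 1)
  | 2 => (v.1, v.2 + 1) | 3 => (v.1 - 1, v.2 + 1)
  | 4 => (v.1 - 1, v.2) | 5 => (v.1 - 1, v.2 - 1)
  | 6 => (v.1, v.2 - 1) | _ => (v.1 + 1, v.2 - 1)
  end.

Lemma shift_exists a b : near a b -> a != b -> exists2 k, (k < 8)%N & b = shift k a.
Proof.
case: a => a1 a2 /near_cases[k1 [k2 [-> /= [|[]] -> [|[]] ->]]] ne;
  first [by rewrite xpair_eqE !addr0 !eqxx in ne | idtac].
- by exists 5.
- by exists 4; rewrite //= addr0.
- by exists 3.
- by exists 6; rewrite //= addr0.
- by exists 2; rewrite //= addr0.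
- by exists 7.
- by exists 0; rewrite //= addr0.
- by exists 1.
Qed.

Lemma shift_inj j k v : (j < 8)%N -> (k < 8)%N -> (shift j v == shift k v) = (j == k).
Proof.
by case: j => [|[|[|[|[|[|[|[|j]]]]]]]] //; case: k => [|[|[|[|[|[|[|[|k]]]]]]]] //;
  rewrite xpair_eqE /=; decide_int_tests.
Qed.

(** Two different edges with the same midpoint are the diagonals of a unit square. *)
Definition crosses (a b d e : int * int) : bool :=
  [&& near a b, near d e, a.1 + b.1 == d.1 + e.1, a.2 + b.2 == d.2 + e.2,
      a != d & a != e].

(** * Uncrossed simple closed paths wind at most once *)

Section SimpleCycle.
Variable c : seq (int * int).
Hypotheses (cyc : cycle near c) (Uc : uniq c) (c_gt1 : (1 < size c)%N).
Hypothesis uncrossed : forall a d, a \in c -> d \in c ->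
  ~~ crosses a (next c a) d (next c d).

Let w v := cycle_sum (crossing v) c.
Let t v z := cycle_sum (flow v z) c.

Lemma next_neq a : a \in c -> next c a != a.
Proof.
move=> ac; apply/eqP => ne; case: (rot_to ac) => i s rot_c.
have Us : uniq (a :: s) by rewrite -rot_c rot_uniq.
move: ne c_gt1; rewrite -(next_rot i Uc) rot_c -(size_rot i) rot_c.
case: s Us {rot_c} => //= b s; rewrite eqxx inE negb_or => /andP[/andP[ab _] _] ba.
by rewrite ba eqxx in ab.
Qed.

Lemma flow_cycle v z : v \in c ->
  t v z = (next c v == z : nat)%:Z - (prev c v == z : nat)%:Z.
Proof.
move=> vc; rewrite /t cycle_sum_next // /flow sumrB; congr (_ - _).
  rewrite (bigD1_seq v) //= eqxx big1 ?addr0 // => a /negPf ->; by rewrite /=.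
rewrite (bigD1_seq (prev c v)) //= ?mem_prev // next_prev // eqxx andbT.
rewrite big_seq_cond big1 ?addr0 // => a /andP[ac ne].
case: (next c a =P v) ne => [<-|_ _]; last by rewrite andbF.
by rewrite prev_next // eqxx.
Qed.

Lemma flow_notin v z : v \notin c -> t v z = 0.
Proof.
move=> vc; rewrite /t cycle_sum_next // /flow big_seq big1 // => a ac.
have -> : (a == v) = false by apply: contraNF vc => /eqP <-.
have -> : (next c a == v) = false by apply: contraNF vc => /eqP <-; rewrite mem_next.
by rewrite andbF.
Qed.

Lemma flow_crossing a d e : a \in c -> crosses a (next c a) d e -> t d e = 0.
Proof.
move=> ac cr; have [dc|dc] := boolP (d \in c); last exact: flow_notin.
rewrite flow_cycle //.
have -> : (next c d == e) = false.
  by apply: contraTF cr => /eqP <-; apply: uncrossed.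
have -> // : (prev c d == e) = false.
apply: contraTF cr => /eqP <-; have := uncrossed ac (_ : prev c d \in c).
rewrite mem_prev next_prev // => /(_ dc); apply: contra.
rewrite /crosses (near_sym (prev c d)) [d.1 + _]addrC [d.2 + _]addrC.
by case/and5P=> -> -> -> -> /andP[-> ->].
Qed.

(* The winding number of c in the k-th of the eight sectors around v, the one
   between the directions k and k + 1. *)
Fixpoint sector_winding (v : int * int) (k : nat) : int :=
  if k is j.+1 then sector_winding v j + t v (shift k v) else w v.

Lemma flow_shift v i o k : v \in c -> (i < 8)%N -> (o < 8)%N -> (k < 8)%N ->
  next c v = shift o v -> prev c v = shift i v ->
  t v (shift k v) = (o == k : nat)%:Z - (i == k : nat)%:Z.
Proof. by move=> vc i8 o8 k8 no pi; rewrite flow_cycle // no pi !shift_inj. Qed.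

Lemma sector_windingE v i o k : v \in c -> (i < 8)%N -> (o < 8)%N -> (k < 8)%N ->
  next c v = shift o v -> prev c v = shift i v ->
  sector_winding v k = w v + (0 < o <= k : nat)%:Z - (0 < i <= k : nat)%:Z.
Proof.
move=> vc i8 o8 k8 no pi; elim: k k8 => [|k IH] k8.
  rewrite /= !leqn0 -!(eq_sym 0%N) !lt0n.
  by case: o {o8 no}; case: i {i8 pi} => * /=; ring.
rewrite [LHS]/= IH ?(ltnW k8) // (flow_shift vc i8 o8 k8 no pi).
by rewrite -!addrA; congr (_ + _); lia.
Qed.

Lemma next_prev_shift v : v \in c -> exists o i,
  [/\ (o < 8)%N, (i < 8)%N, next c v = shift o v & prev c v = shift i v].
Proof.
move=> vc; have [o o8 no] := shift_exists (next_cycle cyc vc)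
  (introN eqP (fun eq => negP (next_neq vc) (introT eqP (esym eq)))).
have pv : near v (prev c v) by rewrite near_sym; apply: prev_cycle.
have [|i i8 pi] := shift_exists pv; last by exists o, i.
have := next_neq (_ : prev c v \in c); rewrite mem_prev next_prev //; exact.
Qed.

Lemma flow_total v : v \in c -> \sum_(0 <= k < 8) t v (shift k v) = 0.
Proof.
move=> vc; have [o [i [o8 i8 no pi]]] := next_prev_shift vc.
rewrite (eq_big_nat _ _ (F2 := fun k => (o == k : nat)%:Z - (i == k : nat)%:Z)).
  case: o o8 no => [|[|[|[|[|[|[|[|o]]]]]]]] // _ _;
    by case: i i8 pi => [|[|[|[|[|[|[|[|i]]]]]]]] // _ _; rewrite unlock.
by move=> k /andP[_ k8]; apply: flow_shift.
Qed.

Local Notation by_lia := ltac:(lia) (only parsing).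

(** From [next c a], the way back has direction [k + 4], so sector [k + 3] there lies, like sector
    [k] at [a], just to the left of the edge. For a diagonal edge the two are separated by the other
    diagonal of the square, which carries no flow. *)
Lemma sector_winding_edge (a : int * int) k :
  a \in c -> (k < 8)%N -> next c a = shift k a ->
  sector_winding a k = sector_winding (next c a) ((k + 3) %% 8).
Proof.
case: a => x y ac k8 nak.
(* Opaque names for the shifted coordinates, so that lia sees the winding numbers
   and flows involved as syntactically equal atoms. *)
have [x1 x1E] : exists z : int, z = x + 1 by exists (x + 1).
have [xm xmE] : exists z : int, z = x - 1 by exists (x - 1).
have [y1 y1E] : exists z : int, z = y + 1 by exists (y + 1).
have [ym ymE] : exists z : int, z = y - 1 by exists (y - 1).
have [x2 x2E] : exists z : int, z = x1 + 1 by exists (x1 + 1).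
have [x1m x1mE] : exists z : int, z = xm - 1 by exists (xm - 1).
have [y2 y2E] : exists z : int, z = y1 + 1 by exists (y1 + 1).
have [y1m y1mE] : exists z : int, z = ym - 1 by exists (ym - 1).
have x1K : x1 - 1 = x by lia.
have xmK : xm + 1 = x by lia.
have y1K : y1 - 1 = y by lia.
have ymK : ym + 1 = y by lia.
have wl := winding_left cyc; have wu := winding_up cyc; have ta := flow_anti cyc.
have no_cross d e : crosses (x, y) (next c (x, y)) d e -> t d e = 0.
  exact: flow_crossing.
have total : \sum_(0 <= j < 8) t (shift k (x, y)) (shift j (shift k (x, y))) = 0.
  by apply: flow_total; rewrite -nak mem_next.
move: no_cross total; rewrite nak unlock.
case: k k8 {nak} => [|[|[|[|[|[|[|[|k]]]]]]]] // _ nc total;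
  rewrite /= /w /t /= in nc total *;
  rewrite -?x1E -?xmE -?y1E -?ymE ?x1K ?xmK ?y1K ?ymK
    -?x2E -?x1mE -?y2E -?y1mE in nc total *.
- by move: (wl x1 y x x2 y1 by_lia by_lia by_lia); lia.
- have := nc (x1, y) (x, y1); rewrite /crosses /near /= !xpair_eqE => /(_ ltac:(lia)).
  by move: (wl x1 y x x2 y1 by_lia by_lia by_lia)
    (wl x1 y1 x x2 y2 by_lia by_lia by_lia)
    (wu x1 y x x2 y1 by_lia by_lia by_lia) (ta x y1 x1 y1); lia.
- by move: (wl x y1 xm x1 y2 by_lia by_lia by_lia)
    (wu x y xm x1 y1 by_lia by_lia by_lia) (ta xm y x y1) (ta xm y1 x y1); lia.
- have := nc (xm, y) (x, y1); rewrite /crosses /near /= !xpair_eqE => /(_ ltac:(lia)).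
  by move: (wl x y xm x1 y1 by_lia by_lia by_lia)
    (wl xm y1 x1m x y2 by_lia by_lia by_lia)
    (wu xm y x1m x y1 by_lia by_lia by_lia) (ta x1m y1 xm y1) (ta x1m y xm y1)
    (ta xm y xm y1); lia.
- by move: total (wl x y xm x1 y1 by_lia by_lia by_lia) (ta xm y x y); lia.
- have := nc (x, ym) (xm, y); rewrite /crosses /near /= !xpair_eqE => /(_ ltac:(lia)).
  by move: (wl x y xm x1 y1 by_lia by_lia by_lia)
    (wu x ym xm x1 y by_lia by_lia by_lia)
    (wl x ym xm x1 y by_lia by_lia by_lia) (ta xm y x y) (ta xm ym x y); lia.
- by move: (wl x y xm x1 y1 by_lia by_lia by_lia)
    (wu x ym xm x1 y by_lia by_lia by_lia)
    (wl x ym xm x1 y by_lia by_lia by_lia)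
    (wl x1 ym x x2 y by_lia by_lia by_lia) (ta xm y x y) (ta xm ym x y)
    (ta x ym x y); lia.
- have := nc (x, ym) (x1, y); rewrite /crosses /near /= !xpair_eqE => /(_ ltac:(lia)).
  by move: (wl x y xm x1 y1 by_lia by_lia by_lia)
    (wu x ym xm x1 y by_lia by_lia by_lia)
    (wl x ym xm x1 y by_lia by_lia by_lia)
    (wl x1 ym x x2 y by_lia by_lia by_lia) (ta xm y x y) (ta xm ym x y)
    (ta x ym x y) (ta x1 ym x y); lia.
Qed.

(** Seen from [v], the left sides of the outgoing and incoming edges are the sectors [o] and [i - 1]
    modulo 8. Turning counterclockwise from the first to the second meets no edge of [c], since [c]
    visits [v] once. *)
Lemma sector_winding_vertex v i o : v \in c -> (i < 8)%N -> (o < 8)%N ->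
  next c v = shift o v -> prev c v = shift i v ->
  sector_winding v o = sector_winding v ((i + 7) %% 8).
Proof.
move=> vc i8 o8 no pi.
rewrite !(sector_windingE vc i8 o8 _ no pi) ?ltn_mod // -!addrA; congr (_ + _).
case: o o8 no => [|[|[|[|[|[|[|[|o]]]]]]]] // _ _;
  by case: i i8 pi => [|[|[|[|[|[|[|[|i]]]]]]]] // _ _.
Qed.

Lemma shift_opposite k v : (k < 8)%N -> shift ((k + 4) %% 8) (shift k v) = v.
Proof.
case: v => x y.
by case: k => [|[|[|[|[|[|[|[|k]]]]]]]] //= _; rewrite ?addrK ?subrK.
Qed.

(** The winding number just to the left of the edge leaving [v]; [index] recovers the direction of
    that edge. *)
Definition left_winding v : int :=
  sector_winding v (index (next c v) [seq shift k v | k <- iota 0 8]).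

Lemma left_windingE v k : (k < 8)%N -> next c v = shift k v ->
  left_winding v = sector_winding v k.
Proof.
move=> k8 nk; rewrite /left_winding nk; congr sector_winding.
have -> : shift k v = nth v [seq shift k v | k <- iota 0 8] k.
  by rewrite (nth_map 0%N) ?size_iota // nth_iota.
rewrite index_uniq ?size_map ?size_iota //.
rewrite map_inj_in_uniq ?iota_uniq // => j l; rewrite !mem_iota /= => j8 l8.
by move/eqP; rewrite shift_inj // => /eqP.
Qed.

Lemma left_winding_next v : v \in c -> left_winding (next c v) = left_winding v.
Proof.
move=> vc; have [k [_ [k8 _ nk _]]] := next_prev_shift vc.
have nc : next c v \in c by rewrite mem_next.
have [o [i [o8 i8 no pi]]] := next_prev_shift nc.
rewrite (left_windingE o8 no) (left_windingE k8 nk) (sector_winding_edge vc k8 nk).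
rewrite (sector_winding_vertex nc i8 o8 no pi); congr sector_winding.
(* The path arrives from the direction opposite to [k], so [k + 3] and [i + 7] agree modulo 8. *)
have /eqP : shift ((k + 4) %% 8) (next c v) == shift i (next c v).
  by rewrite -pi prev_next // nk shift_opposite.
move/eqP; rewrite shift_inj ?ltn_mod // => /eqP <-.
by case: k k8 nk => [|[|[|[|[|[|[|[|k]]]]]]]].
Qed.

Lemma left_winding_const u v : u \in c -> v \in c -> left_winding u = left_winding v.
Proof.
suff const x s : c = x :: s -> {in c, forall a, left_winding x = left_winding a}.
  by case: c const => // x s /(_ _ _ erefl) const uc vc; rewrite -!const.
move=> c_eq; pose same a b := left_winding a == left_winding b.
have : cycle same c.
  by apply: cycle_from_next => // a ac; rewrite /same left_winding_next.
have same_trans : transitive same by move=> a b d /eqP ab; rewrite /same ab.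
rewrite {1}c_eq /= rcons_path => /andP[/(order_path_min same_trans)/allP xs _] a.
by rewrite c_eq inE => /orP[/eqP->//|/xs/eqP].
Qed.

(** The start of the ray for [(xm, y)] lies in sector 3 of [(x, y)]. Turning counterclockwise around
    a vertex, the winding number rises by 1 at the outgoing edge and drops by 1 at the incoming one,
    so the larger value is found on the left of [c]. *)
Lemma winding_jump (xm x y : int) : xm = x - 1 -> w (xm, y) != w (x, y) ->
  (x, y) \in c /\ (w (xm, y) = w (x, y) + 1 /\ left_winding (x, y) = w (xm, y) \/
                  w (xm, y) = w (x, y) - 1 /\ left_winding (x, y) = w (x, y)).
Proof.
move=> xmE; have -> : w (xm, y) = sector_winding (x, y) 3.
  by rewrite xmE; apply: winding_left.
have [vc|vc] := boolP ((x, y) \in c); last first.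
  by rewrite /= !flow_notin // !addr0 eqxx.
have [o [i [o8 i8 no pi]]] := next_prev_shift vc => ne; split=> //.
move: ne; rewrite (left_windingE o8 no) !(sector_windingE vc i8 o8 _ no pi) //.
case: o o8 no => [|[|[|[|[|[|[|[|o]]]]]]]] // _ _;
  by case: i i8 pi => [|[|[|[|[|[|[|[|i]]]]]]]] // _ _ /=; lia.
Qed.

Lemma winding_far y : exists M : nat, forall x, M%:Z <= x -> w (x, y) = 0.
Proof.
have [M ltM] : exists M : nat, {in c, forall a : int * int, a.1 <= M%:Z}.
  elim: c => [|a s [M ltM]]; first by exists 0.
  exists (maxn (absz a.1) M) => b; rewrite inE => /orP[/eqP ->|/ltM]; lia.
exists M => x ltx; rewrite /w cycle_sum_next // big_seq big1 // => a ac.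
have := ltM _ ac; have := ltM (next c a); rewrite mem_next => /(_ ac).
by rewrite /crossing /=; lia.
Qed.

(** A discrete intermediate value argument: to the right of [p] the winding number eventually
    vanishes, so it somewhere drops from [m + 1] to [m]. *)
Lemma left_winding_attained p (m : int) : 0 <= m < w p ->
  exists2 v, v \in c & left_winding v = m + 1.
Proof.
case: p => x y /andP[m_ge0 m_lt]; pose z n : int := x + n%:Z.
pose P n := w (z n, y) <= m.
have exP : exists n, P n.
  have [M wM] := winding_far y; exists (absz (M%:Z - x)).
  by rewrite /P wM // /z; lia.
case: (ex_minnP exP) => [[|n] Pn n_min].
  by move: Pn; rewrite /P /z addr0 leNgt m_lt.
have nPn : m < w (z n, y) by rewrite ltNge; apply/negP => /n_min; rewrite ltnn.
have ne : w (z n, y) != w (z n.+1, y).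
  by apply/eqP => eq; move: nPn; rewrite eq ltNge -/(P n.+1) Pn.
have [|vc jump] := winding_jump _ ne; first by rewrite /z; lia.
by exists (z n.+1, y) => //; move: jump nPn Pn; rewrite /P; lia.
Qed.

(* Going right along the row of p, the winding number drops to 0 by steps of 1,
   and its larger value at each step is the common value of left_winding. *)
Lemma simple_winding_le1 p : cycle_sum (crossing p) c <= 1.
Proof.
rewrite -/(w p) leNgt; apply/negP => w_gt1.
have [u uc lu] := @left_winding_attained p 0 ltac:(lia).
have [v vc] := @left_winding_attained p 1 ltac:(lia).
by rewrite (left_winding_const vc uc) lu.
Qed.

End SimpleCycle.


(** * Splitting closed paths of winding number above 1 *)

(** Being moved down, the start of the ray lies strictly below the antidiagonal of the unit square
    with lower left corner [p]. Hence a triangle of mutually near points contains it only if [p] is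
    a corner. *)
Lemma crossing_cocycle p a b d : near a b -> near b d -> near d a ->
  a != p -> b != p -> d != p -> crossing p a b + crossing p b d + crossing p d a = 0.
Proof.
case: p a b d => p1 p2 [a1 a2] [b1 b2] [d1 d2].
move=> /and4P[/= ? ? ? ?] /and4P[/= ? ? ? ?] /and4P[/= ? ? ? ?].
rewrite !xpair_eqE /crossing /= => ? ? ?.
by decide_int_tests.
Qed.

Lemma crossing_anti p a b : crossing p b a = - crossing p a b.
Proof. by rewrite /crossing opprB. Qed.

Lemma crosses_near a b d e : crosses a b d e ->
  [/\ near a d, near a e, near d b & near e b] /\ [/\ b != d, b != e & a != b].
Proof.
case: a b d e => a1 a2 [b1 b2] [d1 d2] [e1 e2].
rewrite /crosses /near !xpair_eqE /=.
by move=> /and5P[/and4P[? ? ? ?] /and4P[? ? ? ?] ? ? /andP[? ?]]; split; split; lia.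
Qed.

(** Compare the cocycle relations of the triangles [a], [b], [d] and [a], [e], [d]. *)
Lemma crossing_swap p a b d e : crosses a b d e ->
  a != p -> b != p -> d != p -> e != p ->
  crossing p a b + crossing p d e = crossing p a e + crossing p d b.
Proof.
move=> cr ap bp dp ep; have [[ad ae db eb] _] := crosses_near cr.
case/and5P: cr => ab de _ _ _.
have := crossing_cocycle ab (_ : near b d) (_ : near d a) ap bp dp.
have := crossing_cocycle ae (_ : near e d) (_ : near d a) ap ep dp.
rewrite ![near _ d]near_sym ![near d a]near_sym => /(_ de ad) E1 /(_ db ad) E2.
by move: E1 E2; rewrite (crossing_anti p d b) (crossing_anti p d e); lia.
Qed.

(** The cut is made at a repeated vertex or else at two crossing edges, which exist by
    [simple_winding_le1]. *)
Lemma cycle_splitting p c : cycle near c -> p \notin c ->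
  1 < cycle_sum (crossing p) c ->
  exists c1 c2, [/\ cycle near c1, cycle near c2,
    {subset c1 <= c} /\ {subset c2 <= c},
    [/\ size c1 + size c2 = size c, 0 < size c1 & 0 < size c2]%N &
    cycle_sum (crossing p) c =
      cycle_sum (crossing p) c1 + cycle_sum (crossing p) c2].
Proof.
move=> cyc pc w_gt1; have [Uc|nUc] := boolP (uniq c); last first.
  have [x [s1 [s2 [i rot_c]]]] : exists x s1 s2 i, rot i c = x :: s1 ++ x :: s2.
    have [x [s1 [s2 [s3 ->]]]] : exists x s1 s2 s3, c = s1 ++ x :: s2 ++ x :: s3.
      elim: c nUc {cyc pc w_gt1} => //= x s IH; rewrite negb_and negbK.
      case/orP=> [/splitPr[s1 s2]|/IH[y [s1 [s2 [s3 ->]]]]].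
        by exists x, [::], s1, s2.
      by exists y, (x :: s1), s2, s3.
    exists x, s2, (s3 ++ s1), (size s1).
    by rewrite rot_size_cat /= -catA.
  exists (x :: s1), (x :: s2); rewrite -(cycle_sum_rot _ i) rot_c cycle_sum_nested.
  move: cyc; rewrite -(rot_cycle i) rot_c /= rcons_cat cat_path /= => cyc.
  have mem_c := mem_rot i c; rewrite rot_c in mem_c.
  split=> //.
  - by case/and3P: cyc => xs1 s1x _; rewrite /= rcons_path xs1.
  - by case/and3P: cyc.
  - split=> y; rewrite -mem_c !inE mem_cat inE; first by case/orP=> ->; rewrite ?orbT.
    by case/orP=> ->; rewrite ?orbT.
  - by split=> //; rewrite -(size_rot i c) rot_c /= size_cat /=; clear; lia.
have c_gt1 : (1 < size c)%N.
  case: c w_gt1 {cyc pc Uc} => [|a [|b c]] //=.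
  by rewrite /crossing addr0 => w_gt1; exfalso; move: w_gt1; lia.
have [a [d [ac dc cr]]] : exists a d,
    [/\ a \in c, d \in c & crosses a (next c a) d (next c d)].
  apply: contrapT => none; move: w_gt1; rewrite ltNge => /negP; apply.
  apply: simple_winding_le1 => // a d ac dc.
  by apply/negP => cr; apply: none; exists a, d.
have ad : a != d by case/and5P: cr => _ _ _ _ /andP[].
case: (rot_to_arc Uc ac dc ad) => i p1 p2 _ _ rot_c.
have Urot : uniq (a :: p1 ++ d :: p2) by rewrite -rot_c rot_uniq.
have next_a : next c a = head d p1.
  by rewrite -(next_rot i Uc) rot_c; case: (p1) => [|? ?] /=; rewrite eqxx.
have next_d : next c d = head a p2.
  rewrite -(next_rot i Uc) rot_c -cat_cons -(next_rot (size (a :: p1))) //.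
  by rewrite rot_size_cat; case: (p2) => [|? ?] /=; rewrite eqxx.
have [[_ ae db _] [bd be ab]] := crosses_near cr.
move: cr ae db bd be ab; rewrite next_a next_d.
(* Crossing edges share no endpoint, so neither arc is empty. *)
case: p1 p2 {Urot next_a next_d} rot_c => [|b p1] [|e p2] rot_c /= cr ae db bd be ab.
- by case/eqP: bd.
- by case/eqP: bd.
- by case/and5P: cr => _ _ _ _ /andP[_ /eqP].
have mem_c := mem_rot i c; rewrite rot_c in mem_c.
have ne_p x : x \in c -> x != p by move=> xc; apply: contraNneq pc => <-.
have swap : crossing p a b + crossing p d e = crossing p a e + crossing p d b.
  apply: crossing_swap => //; apply: ne_p;
    by rewrite -mem_c !inE ?mem_cat ?inE eqxx ?orbT.
move: cyc; rewrite -(rot_cycle i) rot_c /= rcons_cat cat_path /= rcons_path.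
case/and5P=> _ bp1 p1d _ /andP[ep2 p2a].
(* Replacing the diagonals [a b] and [d e] by the sides [a e] and [d b] reconnects the path into
   two. *)
exists (a :: e :: p2), (b :: rcons p1 d); split.
- by rewrite /= rcons_path ae ep2.
- by rewrite /= !rcons_path last_rcons bp1 p1d.
- split=> x; rewrite -mem_c !inE ?mem_rcons ?mem_cat ?inE.
    by case/or3P=> ->; rewrite ?orbT.
  by case/or3P=> ->; rewrite ?orbT.
- by rewrite -(size_rot i c) rot_c /= size_cat size_rcons /=; split=> //; clear; lia.
rewrite -(cycle_sum_rot _ i) rot_c /= rcons_cat !walk_sum_cat /=.
rewrite !walk_sum_rcons last_rcons.
have -> : crossing p a b = crossing p a e + crossing p d b - crossing p d e.
  by rewrite -swap addrK.
ring.
Qed.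

(** * Around a hole the crossing numbers are not a coboundary *)

Section Hole.
Variables (V : seq (int * int)) (I : pred (int * int)) (p : int * int) (M : nat).
Hypotheses (pV : p \notin V) (Ip : I p).
Hypothesis I_bounded : forall q, I q ->
  - M%:Z <= q.1 <= M%:Z /\ - M%:Z <= q.2 <= M%:Z.
Hypothesis I_border : forall q r, I q -> near q r -> ~~ I r -> r \in V.
Variable h : int * int -> int.
Hypothesis hE : forall q r : int * int, q \in V -> r \in V -> near q r ->
  h r - h q = crossing p q r.

(* The sum of exit_flux over all the sides of all the unit squares, each square
   being run through counterclockwise, vanishes because exit_flux is
   antisymmetric. *)
Definition exit_flux (q r : int * int) : int :=
  (if I q && ~~ I r then h r else 0) - (if ~~ I q && I r then h q else 0).

Let hor (x y : int) := exit_flux (x, y) (x + 1, y).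
Let ver (x y : int) := exit_flux (x, y) (x, y + 1).
Let meets (x y : int) : int := (I (x, y) || I (x, y + 1) : nat)%:Z.

(** As soon as one corner lies in [I], the corners outside [I] lie in [V], where [h] is a constant
    plus a local potential [u]. The constant cancels, since the boundary of the square leaves [I] as
    often as it enters; the right-hand side is the contribution of [u]. *)
Lemma exit_flux_square x y :
  hor x y + ver (x + 1) y - hor x (y + 1) - ver x y =
  if (y == p.2) && (p.1 <= x) then meets (x + 1) y - meets x y else 0.
Proof.
(* [k] tells whether the ray runs through the square, and [u] is a primitive of the crossing numbers
   on the corners other than [p]. *)
pose k : int := if (y == p.2) && (p.1 <= x) then 1 else 0.
pose u (q : int * int) : int := if q.2 == y + 1 then k else 0.
pose corner (q : int * int) := (x <= q.1 <= x + 1) && (y <= q.2 <= y + 1).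
have near_corner q r : corner q -> corner r -> near q r.
  by rewrite /corner /near; lia.
have crossing_corner q r : corner q -> corner r -> q \in V -> r \in V ->
    crossing p q r = u r - u q.
  have ne_p s : s \in V -> s != p by move=> sV; apply: contraNneq pV => <-.
  move=> cq cr /ne_p qp /ne_p rp; move: cq cr qp rp.
  case: q r => q1 q2 [r1 r2]; rewrite /corner /u /k /crossing.
  case: (p) => p1 p2; rewrite !xpair_eqE /=.
  move=> /andP[/andP[? ?] /andP[? ?]] /andP[/andP[? ?] /andP[? ?]] ? ?.
  by decide_int_tests.
have h_corner q r s : corner q -> corner r -> corner s ->
    I q -> ~~ I r -> ~~ I s -> h s - h r = u s - u r.
  move=> cq cr cs Iq nIr nIs.
  have rV : r \in V := I_border Iq (near_corner _ _ cq cr) nIr.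
  have sV : s \in V := I_border Iq (near_corner _ _ cq cs) nIs.
  by rewrite -crossing_corner // hE // near_corner.
pose A := (x, y); pose B := (x + 1, y); pose C := (x + 1, y + 1); pose D := (x, y + 1).
have cA : corner A by rewrite /corner /=; lia.
have cB : corner B by rewrite /corner /=; lia.
have cC : corner C by rewrite /corner /=; lia.
have cD : corner D by rewrite /corner /=; lia.
have uA : u A = 0 by rewrite /u /=; case: eqP => //; lia.
have uB : u B = 0 by rewrite /u /=; case: eqP => //; lia.
have uC : u C = k by rewrite /u /= eqxx.
have uD : u D = k by rewrite /u /= eqxx.
have -> : (if (y == p.2) && (p.1 <= x) then meets (x + 1) y - meets x y else 0) =
    k * (meets (x + 1) y - meets x y).
  by rewrite /k; case: ifP; rewrite ?mul1r ?mul0r.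
have [c0 hc] : exists c0 : int, forall q r, corner q -> corner r -> I q -> ~~ I r ->
    h r = c0 + u r.
  have [[s [cs nIs]]|none] := pselect (exists s, corner s /\ ~~ I s).
    exists (h s - u s) => q r cq cr Iq nIr.
    by rewrite -addrA [- _ + _]addrC -(h_corner q s r) //; ring.
  by exists 0 => q r _ cr _ nIr; case: none; exists r.
have {}hc r q : corner r -> corner q -> I q -> ~~ I r -> h r = c0 + u r.
  by move=> cr cq; apply: hc.
rewrite /hor /ver /meets -/A -/B -/C -/D /exit_flux.
have hA : ~~ I A -> [|| I B, I C | I D] -> h A = c0.
  by move=> nA /or3P[]iX; rewrite (hc _ _ cA _ iX nA) // uA addr0.
have hB : ~~ I B -> [|| I A, I C | I D] -> h B = c0.
  by move=> nB /or3P[]iX; rewrite (hc _ _ cB _ iX nB) // uB addr0.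
have hC : ~~ I C -> [|| I A, I B | I D] -> h C = c0 + k.
  by move=> nC /or3P[]iX; rewrite (hc _ _ cC _ iX nC) // uC.
have hD : ~~ I D -> [|| I A, I B | I C] -> h D = c0 + k.
  by move=> nD /or3P[]iX; rewrite (hc _ _ cD _ iX nD) // uD.
move: hA hB hC hD; case: (I A); case: (I B); case: (I C); case: (I D) => /= hA hB hC hD;
  by rewrite ?hA ?hB ?hC ?hD //; ring.
Qed.

Let in_box (z : int) := - M%:Z <= z <= M%:Z.

(** With this offset the columns run from [- M - 1] to [M + 1], and both outermost ones miss [I]. *)
Let base (n : nat) : int := n%:Z - M%:Z - 1.

Let row_flux (y : int) : int := \sum_(0 <= n < M.*2 + 2) hor (base n) y.

Lemma exit_flux_out q r : ~~ I q -> ~~ I r -> exit_flux q r = 0.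
Proof. by rewrite /exit_flux => /negPf-> /negPf->; rewrite subrr. Qed.

Lemma not_I_out (x y : int) : ~~ (in_box x && in_box y) -> ~~ I (x, y).
Proof. by apply: contra => /I_bounded[/= ? ?]; apply/andP. Qed.

(** Add up [exit_flux_square] over a row of squares. The vertical sides telescope to the outermost
    columns, where the flux is zero; in the row of [p] the [meets] terms telescope to
    [- meets p.1 y], which is -1 because [p] lies in [I]. *)
Lemma row_flux_step (y : int) : row_flux y - row_flux (y + 1) = - (y == p.2 : nat)%:Z.
Proof.
have baseS n : base n + 1 = base n.+1 by rewrite /base; lia.
pose f n := ver (base n) y.
(* Freezing [g] to the left of [p.1] makes its increments vanish before the ray starts, so the whole
   row telescopes. *)
pose g n := if p.1 <= base n then meets (base n) y else meets p.1 y.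
have fE n : hor (base n) y - hor (base n) (y + 1) =
    (if y == p.2 then g n.+1 - g n else 0) - (f n.+1 - f n).
  have := exit_flux_square (base n) y; rewrite /g /f baseS.
  have -> : (if (y == p.2) && (p.1 <= base n)
      then meets (base n.+1) y - meets (base n) y else 0) =
      if y == p.2 then g n.+1 - g n else 0.
    case: (y == p.2) => //=; rewrite /g -baseS.
    have [le|gt] := leP p.1 (base n); first by rewrite ifT //; lia.
    have [le'|_] := leP p.1 (base n + 1); last by rewrite subrr.
    have -> : base n + 1 = p.1 by lia.
    by rewrite subrr.
  by rewrite /g; move=> <-; ring.
rewrite /row_flux -sumrB (eq_bigr _ (fun n _ => fE n)) sumrB telescope_sumr //.
have out_l z : ~~ I (base 0, z) by apply: not_I_out; rewrite /in_box /base; lia.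
have out_r z : ~~ I (base (M.*2 + 2), z).
  by apply: not_I_out; rewrite /in_box /base; lia.
rewrite /f /ver !exit_flux_out // !subr0.
case: eqP => [yE|_]; last by rewrite big1.
have [/andP[p1_ge p1_le] _] := I_bounded Ip.
rewrite telescope_sumr // /g ifT; last by rewrite /base; lia.
rewrite ifF; last by rewrite /base; lia.
have IpE : I (p.1, p.2) by rewrite -surjective_pairing.
by rewrite /meets !(negPf (out_r _)) yE IpE.
Qed.

(** The row flux vanishes above and below the box, yet it changes exactly once, by 1, between the
    rows [p.2] and [p.2 + 1]. *)
Lemma no_hole_potential : False.
Proof.
have row0 y : ~~ in_box y -> row_flux y = 0.
  move=> yout; rewrite /row_flux big1 // => n _.
  by rewrite /hor exit_flux_out //; apply: not_I_out; rewrite (negPf yout) andbF.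
have row_stepE y : y != p.2 -> row_flux y = row_flux (y + 1).
  by move=> /negPf ne; apply/eqP; rewrite -subr_eq0 row_flux_step ne.
have [_ /andP[p2_ge p2_le]] := I_bounded Ip.
have below n : (n <= absz (p.2 + M%:Z + 1)%R)%N -> row_flux (base n) = 0.
  elim: n => [_|n IH n_le]; first by apply: row0; rewrite /in_box /base; lia.
  have -> : base n.+1 = base n + 1 by rewrite /base; lia.
  by rewrite -row_stepE ?IH 1?ltnW //; apply/eqP; move: n_le; rewrite /base; lia.
have above n : (n <= absz (M%:Z - p.2)%R)%N -> row_flux (M%:Z + 1 - n%:Z) = 0.
  elim: n => [_|n IH n_le]; first by apply: row0; rewrite /in_box; lia.
  rewrite row_stepE; last by apply/eqP; move: n_le; lia.
  have -> : M%:Z + 1 - n.+1%:Z + 1 = M%:Z + 1 - n%:Z by lia.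
  by rewrite IH // ltnW.
have := row_flux_step p.2; rewrite eqxx.
have <- : base (absz (p.2 + M%:Z + 1)%R) = p.2 by rewrite /base; lia.
rewrite below //.
have -> : base (absz (p.2 + M%:Z + 1)%R) + 1 = M%:Z + 1 - (absz (M%:Z - p.2)%R)%:Z.
  by rewrite /base; lia.
by rewrite above.
Qed.

End Hole.

Lemma crossing_ge_N1 q a b : - 1 <= crossing q a b.
Proof. by rewrite /crossing; case: andP; case: andP => /= _ _; lia. Qed.

Lemma crossing_le1 q a b : crossing q a b <= 1.
Proof. by rewrite -[crossing _ _ _]opprK -crossing_anti lerNl crossing_ge_N1. Qed.

(** * Rotating [V] along a shortest closed path around [p] *)

Section Retraction.
Variables (V : seq (int * int)) (p : int * int).
Hypothesis pV : p \notin V.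

Let wind := cycle_sum (crossing p).

(** With at most three points a closed path is constant, a return trip or a triangle, and its
    crossing numbers cancel. *)
Lemma winding_cycle_size c : cycle near c -> {subset c <= V} -> 0 < wind c ->
  (3 < size c)%N.
Proof.
move=> cyc cV; have ne_p x : x \in c -> x != p.
  by move=> /cV xV; apply: contraNneq pV => <-.
have c_xx x : crossing p x x = 0 by have := crossing_anti p x x; lia.
case: c cyc cV ne_p => [|a [|b [|d [|e c]]]] //= cyc cV ne_p; rewrite /wind /= ?addr0.
- by rewrite c_xx.
- by rewrite crossing_anti addrC subrr.
- rewrite addrA crossing_cocycle ?ne_p ?inE ?eqxx ?orbT //; by case/and4P: cyc.
Qed.

(** If a shortest path wound more than once, one part of its splitting would wind positively and be
    shorter. The length bound follows by induction on the size of [c'], as sizes and winding numbers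
    both add up under splitting. *)
Lemma shortest_winding_cycle :
  (exists c, [/\ cycle near c, {subset c <= V} & 0 < wind c]) ->
  exists c, [/\ cycle near c, {subset c <= V}, wind c = 1 &
    forall c', cycle near c' -> {subset c' <= V} ->
      wind c' * (size c)%:Z <= (size c')%:Z].
Proof.
move=> winding; pose P n := `[< exists c,
  [/\ cycle near c, {subset c <= V}, 0 < wind c & size c = n] >].
have exP : exists n, P n.
  by case: winding => c [cyc cV w_gt0]; exists (size c); apply/asboolP; exists c.
case: (ex_minnP exP) => n /asboolP[c [cyc cV w_gt0 size_c]] n_min.
have min_n c' : cycle near c' -> {subset c' <= V} -> 0 < wind c' -> (n <= size c')%N.
  by move=> cyc' cV' w'; apply: n_min; apply/asboolP; exists c'.
have split c' : cycle near c' -> {subset c' <= V} -> 1 < wind c' -> exists c1 c2,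
    [/\ cycle near c1 /\ {subset c1 <= V}, cycle near c2 /\ {subset c2 <= V},
     [/\ size c1 + size c2 = size c', 0 < size c1 & 0 < size c2]%N &
     wind c' = wind c1 + wind c2].
  move=> cyc' cV' w_gt1.
  have [|c1 [c2 [cyc1 cyc2 [s1 s2] sizes w12]]] := cycle_splitting cyc' _ w_gt1.
    by apply: contra pV => /cV'.
  by exists c1, c2; split=> //; split=> // x; [move/s1/cV'|move/s2/cV'].
exists c; split=> //.
  apply/eqP; rewrite eq_le -gtz0_ge1 w_gt0 andbT leNgt; apply/negP.
  case/(split c cyc cV)=> c1 [c2 [[cyc1 s1] [cyc2 s2] [sizes gt1 gt2] w12]].
  have := min_n _ cyc1 s1; have := min_n _ cyc2 s2.
  move: sizes gt1 gt2 w_gt0; rewrite size_c w12.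
  by move: (wind c1) (wind c2) (size c1) (size c2); clear; lia.
move=> c'; have [m] := ubnP (size c'); elim: m c' => // m IH c' lt_m cyc' cV'.
have [w_gt1|w_le1] := ltP 1 (wind c').
  have [c1 [c2 [[cyc1 s1] [cyc2 s2] [sizes gt1 gt2] ->]]] := split c' cyc' cV' w_gt1.
  have := IH c1 (ltac:(lia)) cyc1 s1; have := IH c2 (ltac:(lia)) cyc2 s2.
  by rewrite mulrDl -sizes PoszD => ? ?; apply: lerD.
have [w_gt0'|w_le0] := ltP 0 (wind c').
  have -> : wind c' = 1 by lia.
  by rewrite mul1r size_c lez_nat min_n.
apply: le_trans (_ : 0 <= _) => //; rewrite pmulr_lle0 // size_c.
by have := winding_cycle_size cyc cV w_gt0; lia.
Qed.

Lemma rotation_exists :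
  (exists c, [/\ cycle near c, {subset c <= V} & 0 < wind c]) ->
  exists f : int * int -> int * int,
    [/\ {in V, forall x, f x \in V},
        {in V &, forall x y, near x y -> near (f x) (f y)} &
        {in V, forall x, ~~ near (f x) x}].
Proof.
move=> /shortest_winding_cycle[c [cyc cV w1 c_min]].
have n_gt3 : (3 < size c)%N by apply: winding_cycle_size; rewrite ?w1.
pose n : int := (size c)%:Z.
(* The cost of a closed path is its size minus [n] times its winding number: nonnegative by [c_min],
   and zero on [c]. *)
pose cost a b : int := 1 + - n * crossing p a b.
have cost_cycle c' : cycle_sum cost c' = (size c')%:Z - wind c' * n.
  by rewrite /cost cycle_sumD cycle_sumM cycle_sum_size mulNr mulrC.
have [h h_le] : exists h : int * int -> int, forall x y,
    x \in V -> y \in V -> near x y -> h y <= h x + cost x y.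
  apply: (@potential_exists _ _ _ _ (size c)).
    by move=> x y; have := crossing_le1 p x y; rewrite /cost /n; nia.
  by move=> c' cyc' cV'; rewrite cost_cycle subr_ge0 c_min.
(* Using the potential inequality in both directions, [h] modulo [n] changes by at most 1 between
   near points. *)
have h_near (x y : int * int) : x \in V -> y \in V -> near x y ->
    exists2 k : int, -1 <= k <= 1 & h y = h x + k - n * crossing p x y.
  move=> xV yV xy; exists (h y - h x + n * crossing p x y); last by ring.
  have := h_le _ _ xV yV xy; have := h_le _ _ yV xV (etrans (near_sym y x) xy).
  by rewrite /cost (crossing_anti p x y); lia.
have h_walk x s : x \in V -> {subset s <= V} -> path near x s ->
    h (last x s) <= h x + walk_sum cost x s.
  elim: s x => [|y s IH] x xV sV /=; first by rewrite addr0.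
  have yV : y \in V by apply: sV; rewrite mem_head.
  have {}sV : {subset s <= V} by move=> z zs; apply: sV; rewrite inE zs orbT.
  case/andP=> xy /(IH y yV sV); have := h_le _ _ xV yV xy.
  by move=> le1 le2; apply: le_trans le2 _; rewrite [leRHS]addrA lerD2r.
(* As [c] has cost zero, the potential inequalities are equalities along it: [h] grows by 1 per
   step, modulo [n]. *)
have h_cycle x s1 y s2 : c = x :: s1 ++ y :: s2 ->
    exists k, h y = h x + (size s1).+1%:Z + k * n.
  move=> cE; have mem_V z : z \in x :: s1 ++ y :: s2 -> z \in V.
    by rewrite -cE; apply: cV.
  have xV : x \in V by apply: mem_V; rewrite mem_head.
  have yV : y \in V by apply: mem_V; rewrite !(inE, mem_cat) eqxx !orbT.
  have sub1 : {subset rcons s1 y <= V}.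
    move=> z; rewrite mem_rcons inE => /orP[/eqP->//|zs].
    by apply: mem_V; rewrite !(inE, mem_cat) zs !orbT.
  have sub2 : {subset rcons s2 x <= V}.
    move=> z; rewrite mem_rcons inE => /orP[/eqP->//|zs].
    by apply: mem_V; rewrite !(inE, mem_cat) zs !orbT.
  have := cost_cycle c; have := cyc; rewrite w1 mul1r subrr cE /= rcons_cat /=.
  rewrite -cat_rcons cat_path walk_sum_cat last_rcons => /andP[path1 path2].
  have := h_walk _ _ xV sub1 path1; have := h_walk _ _ yV sub2 path2.
  rewrite !last_rcons => le2 le1 sum0.
  have -> : h y = h x + walk_sum cost x (rcons s1 y).
    apply/eqP; rewrite eq_le le1 -(lerD2r (walk_sum cost y (rcons s2 x))).
    by rewrite -addrA sum0 addr0.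
  exists (- walk_sum (crossing p) x (rcons s1 y)).
  by rewrite /cost walk_sumD walk_sumM walk_sum_size size_rcons; ring.
(* [c] indexed cyclically by the integers; the index is always below [size c], so the default [p]
   never occurs. *)
pose pt (z : int) := nth p c (absz (z %% n)%Z).
have n_gt0 : 0 < n by rewrite /n; lia.
have n_neq0 : n != 0 by rewrite gt_eqF.
have idx_lt z : (absz (z %% n)%Z < size c)%N.
  by have := modz_ge0 z n_neq0; have := ltz_pmod z n_gt0; rewrite /n; lia.
have pt_c z : pt z \in c by apply: mem_nth.
have pt_mod k z : pt (k * n + z) = pt z by rewrite /pt modzMDl.
have pt_nat i : (i < size c)%N -> pt i%:Z = nth p c i.
  by move=> lt_i; rewrite /pt modz_small.
have pt_near z : near (pt z) (pt (z + 1)).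
  rewrite (divz_eq z n) -addrA !pt_mod -(gez0_abs (modz_ge0 z n_neq0)).
  move: (absz _) (idx_lt z) => i lt_i; rewrite pt_nat // -PoszD addn1.
  case c_eq: c lt_i cyc => [//|x s] lt_i.
  move=> /= /(pathP p) path_c; have := path_c i; rewrite size_rcons => /(_ lt_i).
  rewrite -rcons_cons nth_rcons lt_i -c_eq nth_rcons.
  (* The last point of [c] is followed by the first, that is, by [pt n]. *)
  have [eq_i|ne_i] := eqVneq i (size s).
    rewrite eq_i ltnn -[_.+1%:Z]addr0 -[_.+1%:Z]mul1r.
    have -> : (size s).+1%:Z = n by rewrite /n c_eq.
    by rewrite pt_mod pt_nat ?c_eq.
  have lt_is : (i < size s)%N by rewrite ltn_neqAle ne_i.
  by rewrite lt_is pt_nat c_eq.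
have h_pt z : exists k, h (pt z) = h (pt 0) + z + k * n.
  rewrite (divz_eq z n) pt_mod -(gez0_abs (modz_ge0 z n_neq0)).
  suff [k hk] : exists k,
      h (pt (absz (z %% n)%Z)) = h (pt 0) + (absz (z %% n)%Z)%:Z + k * n.
    by exists (k - (z %/ n)%Z); rewrite hk; ring.
  move: (absz _) (idx_lt z) => [_|i lt_i]; first by exists 0; rewrite mul0r !addr0.
  rewrite (pt_nat _ lt_i) (pt_nat 0%N (leq_ltn_trans (leq0n _) lt_i)).
  case c_eq: c lt_i => [//|x s] /= lt_i.
  have [|k hk] := h_cycle x (take i s) (nth p s i) (drop i.+1 s).
    by rewrite c_eq -(drop_nth p) ?cat_take_drop.
  by exists k; rewrite hk size_takel // ltnW.
exists (fun x => pt (h x - h (pt 0) + 2)); split.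
- by move=> x _; apply: cV.
- move=> x y xV yV xy; have [k k_small ->] := h_near x y xV yV xy.
  have -> : h x + k - n * crossing p x y - h (pt 0) + 2 =
     (- crossing p x y) * n + (h x - h (pt 0) + 2 + k) by ring.
  rewrite pt_mod; move: (h x - _ + 2) => z.
  have [->|[->|->]] : k = -1 \/ k = 0 \/ k = 1 by lia.
  + by rewrite near_sym -{2}(subrK 1 z) pt_near.
  + by rewrite addr0 near_refl.
  + exact: pt_near.
(* Modulo [n], the image has potential [h x + 2]. Were it near [x], [n] would divide [k + 2], which
   lies between 1 and 3, whereas [n] is at least 4. *)
- move=> x xV; apply/negP => /= near_x.
  have [j h_j] := h_pt (h x - h (pt 0) + 2).
  have [k k_small] := h_near _ _ (cV _ (pt_c _)) xV near_x.
  rewrite h_j; move: (h (pt 0)) (h x) (crossing p _ x) => h0 hx m eq_h.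
  have : (m - j) * n = k + 2 by rewrite mulrBl [m * n]mulrC; lia.
  move: (m - j) => l eq_k; move: eq_k k_small n_gt3; rewrite /n.
  by have [l_le0|l_gt0] := leP l 0; nia.
Qed.

End Retraction.

(** * Back to c_2-adjacency, components and the AFPP *)

Local Open Scope classical_set_scope.

Lemma adj2_near x y : adj 2 x y = (x != y) && near x y.
Proof.
case: x y => x1 x2 [y1 y2]; rewrite /adj /near !xpair_eqE /=; lia.
Qed.

Lemma near_adj2 x y : near x y -> adj 2 x y \/ x = y.
Proof.
by move=> xy; have [->|ne] := eqVneq x y; [right | left; rewrite adj2_near ne].
Qed.

Lemma adj2_sym : symmetric (adj 2).
Proof. by move=> x y; rewrite !adj2_near eq_sym near_sym. Qed.

Lemma dconnected_setU1 (C : set (int * int)) x y :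
  dconnected 2 C -> C x -> adj 2 x y -> dconnected 2 (C `|` [set y]).
Proof.
move=> connC Cx xy; have to_x u : C u -> exists s,
    [/\ path (adj 2) u s, last u s = x & [set` u :: s] `<=` C].
  by move=> Cu; apply: connC.
have yx : adj 2 y x by rewrite adj2_sym.
move=> u v [Cu|->] [Cv|->].
- have [s [us lv sC]] := connC _ _ Cu Cv; exists s; split=> // z /sC; by left.
- have [s [us lx sC]] := connC _ _ Cu Cx; exists (rcons s y); split.
  + by rewrite rcons_path us lx.
  + by rewrite last_rcons.
  + move=> z; rewrite /= -rcons_cons mem_rcons inE => /orP[/eqP->|zs].
      by right.
    by left; apply: sC.
- have [s [us lx sC]] := connC _ _ Cx Cv; exists (x :: s); split=> //=.
  + by rewrite yx.
  + by move=> z; rewrite /= inE => /orP[/eqP->|zs]; [right | left; apply: sC].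
- by exists [::]; split=> // z; rewrite /= inE => /eqP ->; right.
Qed.

Lemma dcomponent_border (A C : set (int * int)) x y :
  dcomponents 2 A C -> C x -> near x y -> ~ C y -> ~ A y.
Proof.
move=> [CA connC maxC] Cx xy nCy Ay; apply: nCy.
have [xy'|<- //] := near_adj2 xy.
have <- : C `|` [set y] = C; last by right.
apply: maxC; last by left.
- by move=> z [/CA|->].
- exact: dconnected_setU1 xy'.
Qed.

(** By its definition the empty set is a component of itself; a point of [A] excludes this, its
    singleton being connected and larger. *)
Lemma dcomponent_neq0 (A C : set (int * int)) x :
  dcomponents 2 A C -> A x -> C !=set0.
Proof.
move=> [CA connC maxC] Ax; apply/set0P/eqP => C0.
have : [set x] = C; last by rewrite C0 => /seteqP[/(_ x erefl)].
apply: maxC.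
- by move=> z ->.
- by move=> u v -> ->; exists [::]; split=> // z; rewrite /= inE => /eqP ->.
- by rewrite C0.
Qed.

Lemma finite_set_bounded (A : set (int * int)) : finite_set A ->
  exists M : nat, forall q, A q -> - M%:Z <= q.1 <= M%:Z /\ - M%:Z <= q.2 <= M%:Z.
Proof.
case/finite_seqP => s ->; elim: s => [|a s [M sM]]; first by exists 0.
exists (maxn M (maxn (absz a.1) (absz a.2))) => q /=; rewrite inE.
by case/orP=> [/eqP ->|/sM[? ?]]; split; lia.
Qed.

Lemma bounded_hole_not_AFPP (X C : set (int * int)) :
  finite_set X -> finite_set C -> dcomponents 2 (~` X) C -> ~ AFPP X.
Proof.
move=> finX finC holeC.
have [M XM] := finite_set_bounded finX.
have [p Cp] : C !=set0.
  (* This point lies to the right of [X], so the complement of [X] is not empty. *)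
  by apply: (@dcomponent_neq0 _ _ (M.+1%:Z, 0) holeC) => /XM[/=]; lia.
have [V XV] : exists V : seq (int * int), X = [set` V] by apply/finite_seqP.
have memV x : (x \in V) = `[< X x >] by rewrite XV; apply/idP/asboolP.
have [N CN] := finite_set_bounded finC.
have pV : p \notin V by rewrite memV; apply/asboolP; case: holeC => + _ _; apply.
have [|f [fV f_near f_far]] := rotation_exists pV.
  apply: contrapT => none.
  (* Without positively winding closed paths, the negated crossing numbers have no negative cycle.
     Since [near] is symmetric and [crossing] antisymmetric, the inequalities for [h] become
     equalities, so [- h] is a primitive of [crossing p]. *)
  have [||h h_le] := @potential_exists _ near (fun a b => crossing p b a) V 1.
  - by move=> x y; apply: crossing_ge_N1.
  - move=> c cyc cV; rewrite leNgt; apply/negP => w_lt0; apply: none.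
    exists c; split=> //.
    have w_anti : cycle_sum (fun a b => crossing p b a) c =
        -1 * cycle_sum (crossing p) c.
      rewrite -cycle_sumM; apply: (eq_cycle_sum _ cyc) => a b _.
      by rewrite crossing_anti mulN1r.
    by move: w_lt0; rewrite w_anti; lia.
  apply: (@no_hole_potential V (fun q => `[< C q >]) p N pV _ _ _ (fun q => - h q)).
  - exact/asboolP.
  - by move=> q /asboolP; apply: CN.
  - move=> q r /asboolP Cq qr /asboolP nCr; rewrite memV; apply/asboolP.
    exact: contrapT (dcomponent_border holeC Cq qr nCr).
  - move=> q r qV rV qr; have := h_le _ _ qV rV qr.
    have := h_le _ _ rV qV (etrans (near_sym r q) qr).
    by rewrite (crossing_anti p q r); lia.
move=> /(_ f)[||x Xx fx].
- by move=> x; rewrite XV; apply: fV.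
- move=> x y; rewrite XV => xV yV; rewrite adj2_near => /andP[_ /(f_near _ _ xV yV)].
  exact: near_adj2.
have xV : x \in V by move: Xx; rewrite XV.
have /negP := f_far x xV; apply; case: fx => [|->]; last exact: near_refl.
by rewrite adj2_near => /andP[].
Qed.

Theorem theorem3p5 (R : realType) (X X' S : set (int * int))
    (finX : finite_set X)
    (cvxX' : digitally_convex_disk R X')
    (bndS : bounding_curve S X')
    (subSX : S `<=` X)
    (holeX : dcomponents 2 (~` X) (X' `\` S))
    (exF : exists F : int * int -> int * int,
       [/\ set_fun S S F, c2_continuous S F &
           forall x, S x -> Nstar X x `&` Nstar X (F x) = set0]) :
  ~ AFPP X.
Proof.
apply: bounded_hole_not_AFPP finX _ holeX.
(* The hole is contained in the interior of [S], which is finite. *)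
case: bndS => _ [I [E [_ finI _ ->]]]; apply: sub_finite_set finI.
by move=> x [[Sx|//] nSx].
Qed.
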